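(* Let $\mathcal{M}$ be a distal $\mathcal{L}$-structure eliminating $\exists^\infty$. Then for any formula $\varphi(x_1,\dots,x_k;z)\in\mathcal{L}$ there are $N\in\mathbb{N}$ and formulas $\psi_i(x_i,y_i)\in\mathcal{L}$, $1\le i\le k$, such that for any $c\in M^{|z|}$, letting $R=\varphi(M^{|x_1|},\dots,M^{|x_k|};c)\subseteq M^{|x_1|}\times\dots\times M^{|x_k|}$, the following are equivalent: (1) there are $A_i\subseteq M^{|x_i|}$ ($1\le i\le k$) with $|A_1|=\dots=|A_k|=N$ and $A_1\times\dots\times A_k\subseteq R$; (2) there are $b_i\in M^{|y_i|}$ such that $\psi_i(M^{|x_i|},b_i)$ is infinite for all $1\le i\le k$ and $\psi_1(M^{|x_1|},b_1)\times\dots\times\psi_k(M^{|x_k|},b_k)\subseteq R$.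
   Context: $\mathcal{M}$ eliminates $\exists^\infty$ if for every formula $\varphi(x,y)$ there is $n_\varphi\in\mathbb{N}$ such that for all $b$, $\varphi(M,b)$ is infinite iff $|\varphi(M,b)|\ge n_\varphi$. $\mathcal{M}$ is distal iff every formula $\varphi(x;y)$ admits a distal cell decomposition: an assignment to each finite $S\subseteq M^{|y|}$ of a family $\mathcal{T}(S)$ of subsets of $M^{|x|}$ covering $M^{|x|}$ such that no member is crossed by any $\varphi(M;s)$, $s\in S$ (a set $A$ crosses $X$ if $X\cap A$ and $X\setminus A$ are non-empty), and such that there exist a finite set of formulas $\Psi(x;y_1,\dots,y_k)$ ($|y_i|=|y|$) and for each $\psi\in\Psi$ a formula $\theta_\psi(y;y_1,\dots,y_k)$ with: $\mathcal{I}(\Delta):=\theta_\psi(M;\bar s)$ depends only on $\Delta=\psi(M;\bar s)$, and $\mathcal{T}(S)=\{\psi(M;\bar s):\psi\in\Psi,\bar s\in S^k,\ \mathcal{I}(\psi(M;\bar s))\cap S=\emptyset\}$ for all finite $S$. *)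

(* Defs.v *)
From Stdlib Require List.
From mathcomp Require Import all_boot.
From mathcomp Require Import boolp classical_sets functions cardinality.

Set Implicit Arguments.
Unset Strict Implicit.
Unset Printing Implicit Defensive.

Local Open Scope classical_set_scope.
Local Open Scope card_scope.

Record language := Language {
  fsym : Type;
  farity : fsym -> nat;
  rsym : Type;
  rarity : rsym -> nat }.

Record structure (L : language) := Structure {
  carrier :> Type;
  carrier_inhabited : inhabited carrier;
  finterp : forall f : fsym L, ('I_(farity f) -> carrier) -> carrier;
  rinterp : forall r : rsym L, ('I_(rarity r) -> carrier) -> Prop }.

(* [formula L V] is the type of first-order L-formulas (without parameters from
   any structure) whose free variables are among V. Under a quantifier the
   variables are [option V], with [None] the bound one. A partitioned formula
   phi(x;y) with |x| = p and |y| = q is a [formula L ('I_p + 'I_q)], and M^p is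
   ['I_p -> M]. *)
Inductive term (L : language) (V : Type) : Type :=
| Var of V
| App (f : fsym L) of ('I_(farity f) -> term L V).

Inductive formula (L : language) (V : Type) : Type :=
| Fal
| Eq of term L V & term L V
| Rel (r : rsym L) of ('I_(rarity r) -> term L V)
| Imp of formula L V & formula L V
| All of formula L (option V).

Section Semantics.
Variables (L : language) (M : structure L).

Fixpoint eval (V : Type) (v : V -> M) (t : term L V) : M :=
  match t with
  | Var x => v x
  | App f ts => finterp (fun i => eval v (ts i))
  end.

Definition scons (V : Type) (a : M) (v : V -> M) (x : option V) : M :=
  if x is Some y then v y else a.

Fixpoint holds (V : Type) (phi : formula L V) : (V -> M) -> Prop :=
  match phi with
  | Fal => fun=> False
  | Eq t u => fun v => eval v t = eval v u
  | Rel r ts => fun v => rinterp (fun i => eval v (ts i))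
  | Imp phi psi => fun v => holds phi v -> holds psi v
  | All phi => fun v => forall a : M, holds phi (scons a v)
  end.

Definition join (X Y : Type) (a : X -> M) (b : Y -> M) (v : X + Y) : M :=
  match v with inl x => a x | inr y => b y end.

(* phi(M; b) *)
Definition defset (X Y : Type) (phi : formula L (X + Y)) (b : Y -> M) :
    set (X -> M) :=
  [set a | holds phi (join a b)].

(* (y_1, ..., y_k) with |y_i| = q, as a single tuple of k * q variables *)
Definition flat (k q : nat) (s : 'I_k -> 'I_q -> M) (v : 'I_k * 'I_q) : M :=
  s v.1 v.2.

(* (x_1, ..., x_k) with |x_i| = p i, as a single tuple of variables *)
Definition dflat (k : nat) (p : 'I_k -> nat) (a : forall i, 'I_(p i) -> M)
    (v : {i : 'I_k & 'I_(p i)}) : M :=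
  a (tag v) (tagged v).

End Semantics.

Definition eliminates_exists_infty (L : language) (M : structure L) : Prop :=
  forall (p q : nat) (phi : formula L ('I_p + 'I_q)),
  exists n : nat, forall b : 'I_q -> M,
    infinite_set (defset phi b) <-> `I_n #<= defset phi b.

Definition crosses (T : Type) (A X : set T) : Prop :=
  X `&` A !=set0 /\ X `\` A !=set0.

(* The covering condition is imposed for nonempty S only: if k > 0, the last
   clause makes T(set0) empty, so requiring T(set0) to cover M^p would force
   k = 0, and no infinite structure would be distal. *)
Definition distal_cell_decomposition (L : language) (M : structure L)
    (p q : nat) (phi : formula L ('I_p + 'I_q))
    (T : set ('I_q -> M) -> set (set ('I_p -> M))) : Prop :=
  [/\ forall S, finite_set S -> S !=set0 -> \bigcup_(D in T S) D = setT,
      forall S, finite_set S -> forall D, T S D ->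
        forall s, S s -> ~ crosses (defset phi s) D
    & exists (k : nat) (Psi : seq (formula L ('I_p + 'I_k * 'I_q)))
        (theta : formula L ('I_p + 'I_k * 'I_q) ->
                 formula L ('I_q + 'I_k * 'I_q)),
        (forall psi psi', List.In psi Psi -> List.In psi' Psi ->
         forall s s' : 'I_k -> 'I_q -> M,
           defset psi (flat s) = defset psi' (flat s') ->
           defset (theta psi) (flat s) = defset (theta psi') (flat s')) /\
        (forall S, finite_set S ->
           T S = [set D | exists (psi : formula L ('I_p + 'I_k * 'I_q))
                                 (s : 'I_k -> 'I_q -> M),
                   [/\ List.In psi Psi, forall i, S (s i),
                       D = defset psi (flat s)
                     & defset (theta psi) (flat s) `&` S = set0]])].

Definition distal (L : language) (M : structure L) : Prop :=
  forall (p q : nat) (phi : formula L ('I_p + 'I_q)),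
  exists T, distal_cell_decomposition (M := M) phi T.

(* A_1 x ... x A_k *)
Definition setprod (I : Type) (T : I -> Type) (A : forall i, set (T i)) :
    set (forall i, T i) :=
  [set a | forall i, A i (a i)].

(* Main.v *)
Require Import Defs.
From mathcomp Require Import all_boot.
From mathcomp Require Import boolp classical_sets functions cardinality.

(** The coordinates are treated one at a time.  Suppose a finite box
    A_1 x ... x A_k lies in R, with A_1 much larger than the other sides, and
    decompose M^|x_1| into distal cells relative to the finitely many points of
    A_2 x ... x A_k.  There are few cells, so by pigeonhole some cell D contains
    many points of A_1; by elimination of exists^infty it is infinite, and since
    it is not crossed and meets A_1, D x A_2 x ... x A_k lies in R.  Now
    R' = {y | D x {y} is contained in R} is definable uniformly in the
    parameters of D, contains A_2 x ... x A_k, and involves one coordinate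
    less. *)

Set Implicit Arguments.
Unset Strict Implicit.
Unset Printing Implicit Defensive.

Local Open Scope classical_set_scope.
Local Open Scope card_scope.

(** * Finite cardinalities and the pigeonhole principle *)

Lemma card_ge_ordP (T : Type) (n : nat) (A : set T) :
  `I_n #<= A <-> exists u : 'I_n -> T, injective u /\ forall i, A (u i).
Proof.
rewrite (card_le_eql card_II); split=> [/card_leP[f]|[u [u_inj Au]]].
  exists (fun i => val (f (SigSub (mem_set (I : [set: 'I_n] i))))); split.
    move=> i j /val_inj /(inj (f := f)).
    by rewrite !in_setT => /(_ isT isT) /(congr1 val).
  by move=> i; apply: set_valP.
rewrite -(card_le_eql (inj_card_eq (f := u) (A := setT) (in2W u_inj))).
by apply: subset_card_le => _ [i _ <-].
Qed.

Lemma infinite_card_ge (T : Type) (A : set T) (n : nat) :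
  infinite_set A -> `I_n #<= A.
Proof. by move=> /infiniteP; apply: card_le_trans; apply: card_leT. Qed.

Lemma card_ge_subset (T : Type) (A : set T) (n : nat) :
  `I_n #<= A -> exists2 B, B `<=` A & B #= `I_n.
Proof.
move=> /card_ge_ordP[u [u_inj Au]]; exists [set u i | i in setT].
  by move=> _ [i _ <-].
rewrite (card_eql (inj_card_eq (in2W u_inj))).
by rewrite card_eq_sym card_II.
Qed.

Lemma pigeonhole_fiber (I J : finType) (h : I -> J) (n : nat) :
  (#|J| * n < #|I|)%N -> exists j, (n < #|[set i | h i == j]%SET|)%N.
Proof.
move=> lt_JnI; apply/existsP; apply: contraTT lt_JnI => /existsPn few.
rewrite -leqNgt -sum1_card (partition_big h predT) //=.
rewrite -[leqRHS]sum_nat_const; apply: leq_sum => j _.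
by have := few j; rewrite -leqNgt -sum1dep_card.
Qed.

(** Choose one [j] for each [i] and take a large fiber. Having more than [n] elements, it is
    nonempty even when [n = 0], which supplies [i]. *)
Lemma pigeonhole_cover (I J : finType) (T : Type) (u : I -> T)
    (D : I -> J -> Prop) (n : nat) :
    injective u -> (#|J| * n < #|I|)%N -> (forall i, exists j, D i j) ->
  exists i j, D i j /\ `I_n #<= [set x | exists2 i, x = u i & D i j].
Proof.
move=> u_inj lt_JnI /choice[h Dh].
have [j lt_n] := pigeonhole_fiber h lt_JnI.
set H := [set i | h i == j]%SET in lt_n.
have HP (l : 'I_#|H|) : h (enum_val l) = j.
  by apply/eqP; have := enum_valP l; rewrite inE.
exists (enum_val (Ordinal (leq_ltn_trans (leq0n n) lt_n))), j.
split; first by rewrite -(HP (Ordinal (leq_ltn_trans (leq0n n) lt_n))).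
apply/card_ge_ordP; exists (fun l => u (enum_val (widen_ord (ltnW lt_n) l))).
split; first by move=> l l' /u_inj /enum_val_inj /(congr1 val) /= /val_inj.
move=> l; exists (enum_val (widen_ord (ltnW lt_n) l)) => //.
by rewrite -(HP (widen_ord (ltnW lt_n) l)).
Qed.

(** * Renaming of variables *)

Section Renaming.
Variable L : language.

Fixpoint term_ren (V W : Type) (f : V -> W) (t : term L V) : term L W :=
  match t with
  | Var x => Var L (f x)
  | App g ts => App (fun i => term_ren f (ts i))
  end.

Fixpoint formula_ren (V W : Type) (f : V -> W) (phi : formula L V) :
    formula L W :=
  match phi with
  | Fal => Fal L W
  | Eq t u => Eq (term_ren f t) (term_ren f u)
  | Rel r ts => Rel (fun i => term_ren f (ts i))
  | Imp phi psi => Imp (formula_ren f phi) (formula_ren f psi)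
  | All phi => All (formula_ren (omap f) phi)
  end.

Variable M : structure L.

Lemma eval_ren (V W : Type) (f : V -> W) (t : term L V) (w : W -> M) :
  eval w (term_ren f t) = eval (w \o f) t.
Proof. by elim: t => [//|g ts IH] /=; congr finterp; apply: funext. Qed.

Lemma holds_ren (V W : Type) (f : V -> W) (phi : formula L V) (w : W -> M) :
  holds (formula_ren f phi) w = holds phi (w \o f).
Proof.
elim: phi W f w
  => {V} [V|V t u|V r ts|V phi IHphi psi IHpsi|V phi IH] W f w //=.
- by rewrite !eval_ren.
- by congr rinterp; apply: funext => i; rewrite eval_ren.
- by rewrite IHphi IHpsi.
- suff E a : holds (formula_ren (omap f) phi) (scons a w) =
             holds phi (scons a (w \o f)).
    by rewrite propeqE; split=> H a; [rewrite -E|rewrite E].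
  by rewrite IH; congr holds; apply: funext => -[].
Qed.

End Renaming.

(** * Closure properties of definable predicates *)

Section Definability.
Variables (L : language) (M : structure L).

Definition definable (V : Type) (P : (V -> M) -> Prop) : Prop :=
  exists phi : formula L V, forall v, holds phi v <-> P v.

Lemma definable_holds (V : Type) (phi : formula L V) : definable (holds phi).
Proof. by exists phi. Qed.

Lemma definable_ren (V W : Type) (f : V -> W) (P : (V -> M) -> Prop) :
  definable P -> definable (fun w => P (w \o f)).
Proof.
by move=> [phi phiP]; exists (formula_ren f phi) => w; rewrite holds_ren.
Qed.

Lemma definable_imp (V : Type) (P Q : (V -> M) -> Prop) :
  definable P -> definable Q -> definable (fun v => P v -> Q v).
Proof.
move=> [phi phiP] [psi psiP]; exists (Imp phi psi) => v /=.
by rewrite phiP psiP.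
Qed.

Lemma definable_False (V : Type) : definable (fun _ : V -> M => False).
Proof. by exists (Fal L V). Qed.

Lemma definable_eq (V : Type) (x y : V) :
  definable (fun v : V -> M => v x = v y).
Proof. by exists (Eq (Var L x) (Var L y)). Qed.

Lemma definable_or (V : Type) (P Q : (V -> M) -> Prop) :
  definable P -> definable Q -> definable (fun v => P v \/ Q v).
Proof.
move=> dP dQ.
have [phi phiP] := definable_imp (definable_imp dP (definable_False V)) dQ.
exists phi => v; rewrite phiP; split=> [H|[p nP|//]]; last by case: (nP p).
by have [p|/H] := pselect (P v); [left|right].
Qed.

Lemma definable_and (V : Type) (P Q : (V -> M) -> Prop) :
  definable P -> definable Q -> definable (fun v => P v /\ Q v).
Proof.
move=> dP dQ; have [phi phiP] := definable_imp
  (definable_imp dP (definable_imp dQ (definable_False V))) (definable_False V).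
exists phi => v; rewrite phiP; split=> [H|[p q] H]; last exact: (H p q).
by apply: contrapT => nPQ; apply: H => p q; apply: nPQ.
Qed.

Lemma definable_exists_fin (V : Type) (J : finType)
    (P : J -> (V -> M) -> Prop) :
  (forall j, definable (P j)) -> definable (fun v => exists j, P j v).
Proof.
move=> dP.
suff H (s : seq J) : definable (fun v => exists2 j, j \in s & P j v).
  have [phi phiP] := H (enum J); exists phi => v; rewrite phiP.
  by split=> [[j _ Pj]|[j Pj]]; exists j; rewrite ?mem_enum.
elim: s => [|j s IH].
  have [phi phiP] := definable_False V; exists phi => v; rewrite phiP.
  by split=> // -[].
have [phi phiP] := definable_or (dP j) IH; exists phi => v; rewrite phiP.
split=> [[Pj|[i si Pi]]|[i]]; first by exists j; rewrite ?mem_head.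
  by exists i; rewrite // inE si orbT.
by rewrite inE => /predU1P[->|]; [left|right; exists i].
Qed.

Lemma definable_forall (V : Type) (P : (option V -> M) -> Prop) :
  definable P -> definable (fun v => forall a, P (scons a v)).
Proof.
by move=> [phi phiP]; exists (All phi) => v; split=> H a; apply/phiP; apply: H.
Qed.

(** Induction on [n]: coordinate [ord0] becomes the variable bound by [All], and the other
    coordinates are quantified by the induction hypothesis over [option V]. *)
Lemma definable_forall_tuple (V : Type) (n : nat)
    (P : ('I_n + V -> M) -> Prop) :
  definable P -> definable (fun v => forall a : 'I_n -> M, P (join a v)).
Proof.
elim: n V P => [|n IH] V P dP.
  have f0 (i : 'I_0) : V by case: i.
  pose f (x : 'I_0 + V) := match x with inl i => f0 i | inr y => y end.
  have [phi phiP] := definable_ren f dP; exists phi => v; rewrite phiP.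
  have E a : join a v = v \o f by apply: funext => -[[]|].
  by split=> [H a|/(_ (fun i => v (f0 i)))]; rewrite E.
pose f (x : 'I_n.+1 + V) : 'I_n + option V :=
  match x with
  | inl i => if unlift ord0 i is Some j then inl j else inr None
  | inr y => inr (Some y)
  end.
have [phi phiP] := definable_forall (IH _ _ (definable_ren f dP)).
exists phi => v; rewrite phiP; split=> [H a|H a0 a].
  have := H (a ord0) (a \o lift ord0); congr P; apply: funext => -[i|//] /=.
  by case: unliftP => [j|] ->.
have := H (fun i => if unlift ord0 i is Some j then a j else a0); congr P.
by apply: funext => -[i|//] /=; case: (unlift ord0 i).
Qed.

End Definability.

(** * Distal cells, with parameters indexed by finite types *)

Section Distality.
Variables (L : language) (M : structure L).

Definition uniformly_definable (p : nat) (F : set (set ('I_p -> M))) : Prop :=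
  exists (q : nat) (psi : formula L ('I_p + 'I_q)),
    forall D, F D -> exists b, D = defset psi b.

Definition ren_param (X Y Z : Type) (f : Y -> Z) (v : X + Y) : X + Z :=
  match v with inl x => inl x | inr y => inr (f y) end.

Lemma defset_ren (X Y Z : Type) (f : Y -> Z) (phi : formula L (X + Y))
    (b : Z -> M) :
  defset (formula_ren (ren_param f) phi) b = defset phi (b \o f).
Proof.
apply: funext => a; rewrite /defset /mkset holds_ren; congr holds.
by apply: funext => -[].
Qed.

(** Distality and elimination speak of parameters indexed by ordinals; this reindexing makes them
    available for any finite type. *)
Lemma defset_ren_enum (p : nat) (Y : finType) (phi : formula L ('I_p + Y))
    (b : Y -> M) :
  defset phi b =
  defset (formula_ren (ren_param enum_rank) phi) (b \o enum_val).
Proof.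
by rewrite defset_ren; congr defset; apply: funext => y /=; rewrite enum_rankK.
Qed.

Lemma uniformly_definable_defset (p : nat) (Y : finType)
    (phi : formula L ('I_p + Y)) : uniformly_definable (range (defset phi)).
Proof.
exists #|Y|, (formula_ren (ren_param enum_rank) phi) => D [b _ <-].
by exists (b \o enum_val); rewrite defset_ren_enum.
Qed.

Lemma eliminates_exists_infty_fin (p : nat) (Y : finType)
    (phi : formula L ('I_p + Y)) :
    eliminates_exists_infty M ->
  exists n, forall b : Y -> M,
    `I_n #<= defset phi b -> infinite_set (defset phi b).
Proof.
move=> /(_ p _ (formula_ren (ren_param enum_rank) phi))[n nP].
by exists n => b; rewrite defset_ren_enum => /nP.
Qed.

(* Which member of the family is meant is recorded by the equality pattern of
   extra parameters, which requires two distinct elements. *)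
Lemma code_formulas (X : Type) (V J : finType)
    (psi : J -> formula L (X + V)) (a0 a1 : M) :
    a0 <> a1 ->
  exists (W : finType) (chi : formula L (X + W))
    (enc : J -> (V -> M) -> W -> M),
    forall j b, defset chi (enc j b) = defset (psi j) b.
Proof.
move=> a01; exists (V + option J)%type.
pose P j (w : X + (V + option J) -> M) :=
  w (inr (inr (Some j))) = w (inr (inr None)) /\
  holds (psi j) (w \o ren_param inl).
have [j|chi chiP] := definable_exists_fin (P := P).
  apply: definable_and; first exact: definable_eq.
  exact/definable_ren/definable_holds.
exists chi, (fun j b => join b (fun o => if o is Some i then
                                  if i == j then a0 else a1 else a0)).
move=> j b; apply/seteqP; split=> x; rewrite /defset /mkset chiP /P.
  move=> [i [/=]]; case: eqVneq => [->|_ /esym//] _.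
  by congr holds; apply: funext => -[].
move=> psix; exists j; rewrite /= eqxx; split=> //.
by move: psix; congr holds; apply: funext => -[].
Qed.

Lemma In_tnth (T : Type) (s : seq T) (x : T) :
  List.In x s -> exists i, x = tnth (in_tuple s) i.
Proof.
elim: s => [//|y s IH] /= [->|/IH[i ->]]; first by exists ord0.
by exists (lift ord0 i); rewrite !(tnth_nth y).
Qed.

(* [J] is chosen before [s]: the number of cells depends only on the number of
   parameters, which the pigeonhole argument needs. *)
Lemma distal_cells (hdistal : distal M) (p : nat) (Y : finType)
    (phi : formula L ('I_p + Y)) :
  exists (W : finType) (chi : formula L ('I_p + W)),
  forall S : finType, exists J : finType,
  forall s : S -> Y -> M, inhabited S ->
  exists t : J -> W -> M, forall x, exists j, defset chi (t j) x /\
    forall x', defset chi (t j) x' ->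
    forall l, defset phi (s l) x -> defset phi (s l) x'.
Proof.
have [[a0 [a1 a01]]|M1] := pselect (exists a0 a1 : M, a0 <> a1); last first.
  (* If [M] has a single element, so has [M^p], and a tautology defines the one cell needed. *)
  exists unit, (Imp (Fal L _) (Fal L _)) => S; exists unit => s _.
  have [a] := carrier_inhabited M.
  exists (fun _ _ => a) => x; exists tt; split=> // x' _ l; congr defset.
  by apply: funext => i; apply: contrapT => ne; apply: M1; exists (x i), (x' i).
have [T [Tcov Tcross [k [Psi [theta [_ TE]]]]]] :=
  hdistal _ _ (formula_ren (ren_param enum_rank) phi).
have [W [chi [enc encE]]] := code_formulas (tnth (in_tuple Psi)) a01.
(* A cell is named by a formula of [Psi] and a [k]-tuple from [S]. Names violating the [theta]
   condition are harmless: each [x] only has to find one good [j]. *)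
exists W, chi => S; exists ('I_(size Psi) * {ffun 'I_k -> S})%type => s [l0].
pose s' l : 'I_#|Y| -> M := s l \o enum_val.
exists (fun jf : 'I_(size Psi) * {ffun 'I_k -> S} =>
          enc jf.1 (flat (fun i => s' (jf.2 i)))) => x.
have Sfin : finite_set (range s') by apply: finite_image; apply: finite_finset.
have [D TD Dx] : (\bigcup_(D in T (range s')) D) x.
  by rewrite Tcov //; exists (s' l0); exists l0.
have := TD; rewrite (TE _ Sfin) => -[psi [t [Psipsi tS DE _]]].
have [j psiE] := In_tnth Psipsi; rewrite psiE in DE.
have /choice[f ft] i : exists l, s' l = t i by have [l _] := tS i; exists l.
exists (j, finfun f); rewrite /= encE.
have -> : (fun i => s' (finfun f i)) = t.
  by apply: funext => i; rewrite ffunE ft.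
rewrite -DE; split=> // x' Dx' l; rewrite defset_ren_enum => phix.
apply: contrapT => nphix'.
by apply: (Tcross _ Sfin D TD (s' l)); [exists l|split; [exists x|exists x']].
Qed.

End Distality.

(** * Boxes and the induction on coordinates *)

Section Box.
Variables (L : language) (M : structure L) (k : nat) (p : 'I_k -> nat).
Implicit Types (A : forall i, set ('I_(p i) -> M)).
Implicit Types (e : forall i, 'I_(p i) -> M).

(* Freezing the coordinates outside [s] at [e] lets the induction drop
   coordinates without changing the ambient product. *)
Definition box (s : seq 'I_k) A e : set (forall i, 'I_(p i) -> M) :=
  [set a | forall i, if i \in s then A i (a i) else a i = e i].

(** Makes block [i0] the object variables and everything else parameters. Block [i0] stays in the
    parameter type, but no variable is sent there. *)
Definition isolate (Z : Type) (i0 : 'I_k) (v : {i : 'I_k & 'I_(p i)} + Z) :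
    'I_(p i0) + ({i : 'I_k & 'I_(p i)} + Z) :=
  match v with
  | inl u => untag (inr (inl u)) inl u
  | inr z => inr (inr z)
  end.

Lemma join_isolate (Z : Type) (i0 : 'I_k) (x : 'I_(p i0) -> M) e (c : Z -> M) :
  join x (join (dflat e) c) \o isolate i0 = join (dflat (dfwith e x)) c.
Proof.
apply: funext => -[[i v]|//] /=; rewrite /dflat /=.
have [i0i|ne_i] := eqVneq i0 i; last first.
  by rewrite dfwith_out // untag_dflt //= eq_sym.
case: _ / i0i v => v; rewrite dfwith_in.
by rewrite (untagE _ _ (erefl : tag (Tagged (fun i => 'I_(p i)) v) = i0)).
Qed.

(** Quantifying over block [i0] defines the set R' of the overview. Coordinate [i0] of [e] is
    overwritten, so its value is immaterial. *)
Lemma definable_fiber (Z W : Type) (i0 : 'I_k)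
    (phi : formula L ({i : 'I_k & 'I_(p i)} + Z))
    (chi : formula L ('I_(p i0) + W)) :
  exists phi' : formula L ({i : 'I_k & 'I_(p i)} + (W + Z)),
  forall (w : W -> M) (c : Z -> M) e,
    defset phi' (join w c) (dflat e) <->
    forall x, defset chi w x -> defset phi c (dflat (dfwith e x)).
Proof.
pose f (v : 'I_(p i0) + W) : 'I_(p i0) + ({i : 'I_k & 'I_(p i)} + (W + Z)) :=
  ren_param (fun w => inr (inl w)) v.
pose g (v : {i : 'I_k & 'I_(p i)} + Z) :
    'I_(p i0) + ({i : 'I_k & 'I_(p i)} + (W + Z)) :=
  isolate i0 (ren_param inr v).
have dchi := definable_ren f (definable_holds M chi).
have dphi := definable_ren g (definable_holds M phi).
have [phi' phi'P] := definable_forall_tuple (definable_imp dchi dphi).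
exists phi' => w c e; rewrite /defset /mkset phi'P.
have Ef x : join x (join (dflat e) (join w c)) \o f = join x w.
  by apply: funext => -[].
have Eg x : join x (join (dflat e) (join w c)) \o g =
            join (dflat (dfwith e x)) c.
  transitivity (join (dflat (dfwith e x)) (join w c) \o ren_param inr).
    by rewrite -join_isolate.
  by apply: funext => -[].
by split=> H x; have := H x; rewrite Ef Eg.
Qed.

(** Induction on [s]. Since the induction hypothesis is applied to the formula for R', it must hold
    for all [Z] and [phi]; [N] and [F] precede [c] for uniformity. *)
Lemma infinite_box (hdistal : distal M) (helim : eliminates_exists_infty M)
    (s : seq 'I_k) :
  uniq s ->
  forall (Z : finType) (phi : formula L ({i : 'I_k & 'I_(p i)} + Z)),
  exists (N : nat) (F : forall i, set (set ('I_(p i) -> M))),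
  (forall i, uniformly_definable (F i)) /\
  forall (c : Z -> M) e A,
    (forall i, i \in s -> `I_N #<= A i) ->
    (forall a, box s A e a -> defset phi c (dflat a)) ->
    exists B, (forall i, i \in s -> infinite_set (B i) /\ F i (B i)) /\
      forall a, box s B e a -> defset phi c (dflat a).
Proof.
elim: s => [_|i0 s IH /= /andP[i0s /IH{}IH]] Z phi.
  (* For empty [s] the box is the single point [e], whatever its sides. *)
  exists 0, (fun=> set0); split=> [i|c e A _ H]; first by exists 0, (Fal L _).
  by exists A; split.
have [W [chi cells]] := distal_cells hdistal (formula_ren (isolate i0) phi).
have [n nP] := eliminates_exists_infty_fin chi helim.
have [phi' phi'P] := definable_fiber phi chi.
have [N0 [F [Fdef FP]]] := IH _ phi'.
(* Functions into ['I_N0.+1] index a grid of parameters, so the number of cells is fixed before [c],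
   [e] and [A] are given. *)
have [J JP] := cells {ffun 'I_k -> 'I_N0.+1}.
(* The second bound feeds the pigeonhole on side [i0]. Using [N0.+1] instead of [N0] keeps the grid
   nonempty, as [distal_cells] requires. *)
exists (maxn N0.+1 (#|J| * n).+1), (dfwith F (range (defset chi))); split.
  by move=> i; case: dfwithP => // *; apply: uniformly_definable_defset.
move=> c e A Abig AR.
have [u [u_s u_e]] : exists u : forall i, 'I_N0.+1 -> 'I_(p i) -> M,
    (forall i, i \in s -> injective (u i) /\ forall l, A i (u i l)) /\
    (forall i, i \notin s -> u i = fun=> e i).
  have H i : exists ui : 'I_N0.+1 -> 'I_(p i) -> M,
      (i \in s -> injective ui /\ forall l, A i (ui l)) /\
      (i \notin s -> ui = fun=> e i).
    case: (boolP (i \in s)) => [si|nsi]; last by exists (fun=> e i).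
    have /card_ge_ordP[v vP] : `I_N0.+1 #<= A i.
      apply: card_le_trans (Abig i _); last by rewrite inE si orbT.
      by rewrite card_le_II leq_maxl.
    by exists v.
  exists (fun i => projT1 (cid (H i))).
  by split=> i si; have [H1 H2] := projT2 (cid (H i)); [apply: H1|apply: H2].
have [|t tP] := JP (fun f => join (dflat (fun i => u i (f i))) c).
  by split; exact: [ffun=> ord0].
have /card_ge_ordP[v [v_inj vA]] := Abig i0 (mem_head _ _).
(* Cell [j] contains [v l], and its product with the whole grid lies in R. *)
pose D l j := defset chi (t j) (v l) /\ forall x, defset chi (t j) x ->
  forall f : {ffun 'I_k -> 'I_N0.+1},
    defset phi c (dflat (dfwith (fun i => u i (f i)) x)).
have [|l|l [j [[_ Dphi] Dbig]]] := pigeonhole_cover (D := D) (n := n) v_inj.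
- by rewrite card_ord; apply: leq_maxr.
- have [j [chiv jP]] := tP (v l); exists j; split=> // x chix f.
  have := jP x chix f; rewrite /defset /mkset !holds_ren !join_isolate; apply.
  apply: AR => i; rewrite inE.
  case: dfwithP => [|i' ne_i]; first by rewrite eqxx.
  rewrite eq_sym (negPf ne_i) /=.
  by case: ifP => [/u_s[]//|/negbT/u_e->].
(* The induction hypothesis is applied to the grid, whose sides have [N0.+1] points, inside R'. *)
have [|a sa|B [Binf BR]] := FP (join (t j) c) e (fun i => range (u i)).
- move=> i /u_s[u_inj _]; apply/card_ge_ordP.
  exists (u i \o widen_ord (leqnSn N0)); split; last first.
    by move=> m; exists (widen_ord (leqnSn N0) m).
  by move=> m m' /u_inj /(congr1 val) /= /val_inj.
- apply/phi'P => x chix.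
  have /choice[f fa] i : exists l, u i l = a i.
    have := sa i; case: ifP => [_ [l' _]|/negbT/u_e-> ->]; first by exists l'.
    by exists ord0.
  have := Dphi x chix (finfun f); congr (defset phi c (dflat (dfwith _ x))).
  by apply: functional_extensionality_dep => i; rewrite ffunE fa.
exists (dfwith B (defset chi (t j))); split=> [i|a sa].
  rewrite inE; have [<- _|ne_i /= si] := eqVneq i0 i; last first.
    by rewrite !dfwith_out //; apply: Binf.
  rewrite !dfwith_in; split; last by exists (t j).
  (* The cell contains at least [n] of the points [v l], hence is infinite by elimination. *)
  apply: nP; apply: card_le_trans Dbig _; apply: subset_card_le.
  by move=> _ [l' -> []].
have chia : defset chi (t j) (a i0).
  by have := sa i0; rewrite mem_head dfwith_in.
(* Resetting coordinate [i0] to [e i0] puts [a] in the smaller box; membership in R' then allows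
   [a i0] to be restored. *)
have /phi'P/(_ _ chia) : defset phi' (join (t j) c) (dflat (dfwith a (e i0))).
  apply: BR => i; case: dfwithP => [|i' ne_i]; first by rewrite (negPf i0s).
  by have := sa i'; rewrite inE eq_sym (negPf ne_i) /= dfwith_out.
congr (defset phi c (dflat _)); apply: functional_extensionality_dep => i.
by case: dfwithP => // i' ne_i; rewrite dfwith_out.
Qed.

End Box.

Theorem theorem5p11 (L : language) (M : structure L)
    (hdistal : distal M) (helim : eliminates_exists_infty M)
    (k : nat) (p : 'I_k -> nat) (m : nat)
    (phi : formula L ({i : 'I_k & 'I_(p i)} + 'I_m)) :
  exists (N : nat) (q : 'I_k -> nat)
         (psi : forall i : 'I_k, formula L ('I_(p i) + 'I_(q i))),
  forall c : 'I_m -> M,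
    let R : set (forall i : 'I_k, 'I_(p i) -> M) :=
      [set a | defset phi c (dflat a)] in
    (exists A : forall i : 'I_k, set ('I_(p i) -> M),
        (forall i : 'I_k, A i #= `I_N) /\ setprod A `<=` R)
    <->
    (exists b : forall i : 'I_k, 'I_(q i) -> M,
        (forall i : 'I_k, infinite_set (defset (psi i) (b i))) /\
        setprod (fun i : 'I_k => defset (psi i) (b i)) `<=` R).
Proof.
(* When all coordinates are listed, the box is the full product and any base point will do. *)
have [N [F [Fdef FP]]] := infinite_box hdistal helim (enum_uniq 'I_k) phi.
pose q i := projT1 (cid (Fdef i)).
pose psi i : formula L ('I_(p i) + 'I_(q i)) :=
  projT1 (cid (projT2 (cid (Fdef i)))).
have psiP i : forall D, F i D -> exists b, D = defset (psi i) b.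
  exact: projT2 (cid (projT2 (cid (Fdef i)))).
exists N, q, psi => c R; split=> [[A [AN AR]]|[b [binf bR]]].
  have [a0] := carrier_inhabited M.
  have [i _|a sa|B [Binf BR]] := FP c (fun _ _ => a0) A.
  - by rewrite (card_le_eqr (AN i)).
  - by apply: AR => i; have := sa i; rewrite mem_enum.
  have bP i : exists b, B i = defset (psi i) b.
    by apply: psiP; have [|//] := Binf i; rewrite mem_enum.
  exists (fun i => projT1 (cid (bP i))); split=> [i|a sa].
    by rewrite -(projT2 (cid (bP i))); have [|//] := Binf i; rewrite mem_enum.
  by apply: BR => i; rewrite mem_enum (projT2 (cid (bP i))); apply: sa.
(* Conversely, each infinite side is cut down to exactly [N] points; the smaller product stays in
   [R]. *)
have subP i : exists A, A `<=` defset (psi i) (b i) /\ A #= `I_N.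
  have [A sA AN] := card_ge_subset (infinite_card_ge N (binf i)).
  by exists A.
exists (fun i => projT1 (cid (subP i))); split=> [i|a sa].
  exact: (projT2 (cid (subP i))).2.
by apply: bR => i; apply: (projT2 (cid (subP i))).1; apply: sa.
Qed.
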